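(* Let $F:\Omega\to\mathbb R$, $F(x)=\sum_{(i,j)\in\mathcal E}f_{i,j}(x_i,x_j)$, be a sum of bivariates. The optimal values of the following three maximization problems are equal. (Separable local lower bound) Maximize $\min_{x\in\Omega}P(x)$ over $P\in\mathbb R^\Omega$ subject to: $P$ is separable, and $P(x)=\sum_{(i,j)\in\mathcal E}\tilde\rho_{i,j}(x_i,x_j)$ for all $x\in\Omega$ for some $\tilde\rho_{i,j}\in\mathbb R^{\Omega_i\times\Omega_j}$ with $\tilde\rho_{i,j}\le f_{i,j}$ pointwise, for all $(i,j)\in\mathcal E$. (Dual tree relaxation) Maximize $\sum_{i\in\mathcal V}\min_{x_i\in\Omega_i}\sum_{j\in\widetilde{\mathcal N}(i)}\rho_{i,j}(x_i)$ over $\rho_{i,j}\in\mathbb R^{\Omega_i}$, $\rho_{j,i}\in\mathbb R^{\Omega_j}$ ($(i,j)\in\mathcal E$) subject to $\rho_{i,j}(x_i)+\rho_{j,i}(x_j)\le f_{i,j}(x_i,x_j)$ for all $x_i\in\Omega_i$, $x_j\in\Omega_j$, $(i,j)\in\mathcal E$. (Dual linear program) Maximize $\sum_{i\in\mathcal V}\rho_i$ over $\rho_i\in\mathbb R$ ($i\in\mathcal V$), $\rho_{i,j}\in\mathbb R^{\Omega_i}$, $\rho_{j,i}\in\mathbb R^{\Omega_j}$ ($(i,j)\in\mathcal E$) subject to $\rho_{i,j}(x_i)+\rho_{j,i}(x_j)\le f_{i,j}(x_i,x_j)$ for all $x_i\in\Omega_i$, $x_j\in\Omega_j$, $(i,j)\in\mathcal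 E$, and $\sum_{j\in\widetilde{\mathcal N}(i)}\rho_{i,j}(x_i)=\rho_i$ for all $x_i\in\Omega_i$, $i\in\mathcal V$.
   Context: $\mathcal V=\{1,\dots,n\}$, $\mathcal E\subseteq\{(i,j)\in\mathcal V\times\mathcal V:i<j\}$, $\Omega_1,\dots,\Omega_n\subset\mathbb R$ finite nonempty sets, $\Omega=\Omega_1\times\dots\times\Omega_n$, and $f_{i,j}:\Omega_i\times\Omega_j\to\mathbb R$. $\widetilde{\mathcal N}(i)=\{j\in\mathcal V:(i,j)\in\mathcal E\text{ or }(j,i)\in\mathcal E\}$ is the set of neighbors of $i$. A function $P:\Omega\to\mathbb R$ is separable if there are $p_i\in\mathbb R^{\Omega_i}$ with $P(x)=p_1(x_1)+\dots+p_n(x_n)$ for all $x\in\Omega$. *)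

(* Defs.v *)
From HB Require Import structures.
From mathcomp Require Import all_boot all_order all_algebra finmap.
From mathcomp Require Import boolp classical_sets reals constructive_ereal ereal.

Set Implicit Arguments.
Unset Strict Implicit.
Unset Printing Implicit Defensive.

Import Order.TTheory GRing.Theory Num.Theory.

Local Open Scope classical_set_scope.
Local Open Scope ring_scope.

(* The minimum of a real function over a finite type, as an extended real;
   the value is +oo only when the type is empty. *)
Definition fin_min (R : realType) (T : finType) (g : T -> R) : \bar R :=
  \big[Order.min/+oo%E]_(x : T) (g x)%:E.

Definition opt_value (R : realType) (T : Type) (feasible : set T)
    (objective : T -> \bar R) : \bar R :=
  ereal_sup [set objective t | t in feasible].

Definition config (R : realType) (n : nat) (Om : 'I_n -> {fset R}) :=
  {dffun forall i : 'I_n, Om i}.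

(* Bivariate families are total in (i, j); only the pairs in E are ever used. *)
Definition bivariates (R : realType) (n : nat) (Om : 'I_n -> {fset R}) :=
  forall i j : 'I_n, Om i -> Om j -> R.

(* For a univariate family, r i j is a function on Om i; for an edge (i, j)
   both r i j and r j i occur, and the other values are never used. *)
Definition messages (R : realType) (n : nat) (Om : 'I_n -> {fset R}) :=
  forall i j : 'I_n, Om i -> R.

Definition neighbors (n : nat) (E : {set 'I_n * 'I_n}) (i : 'I_n) :
    {set 'I_n} :=
  [set j | ((i, j) \in E) || ((j, i) \in E)].

Section Problems.
Variables (R : realType) (n : nat) (Om : 'I_n -> {fset R}).
Variables (E : {set 'I_n * 'I_n}).

Definition sum_bivariates (g : bivariates Om) (x : config Om) : R :=
  \sum_(e in E) g e.1 e.2 (x e.1) (x e.2).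

Definition separable (P : config Om -> R) : Prop :=
  exists p : forall i : 'I_n, Om i -> R,
    forall x : config Om, P x = \sum_(i < n) p i (x i).

Definition separable_feasible (f : bivariates Om) : set (config Om -> R) :=
  [set P | separable P /\
    exists rho : bivariates Om,
      (forall i j, (i, j) \in E -> forall xi xj, rho i j xi xj <= f i j xi xj) /\
      (forall x, P x = sum_bivariates rho x)].

Definition separable_bound_value (f : bivariates Om) : \bar R :=
  opt_value (separable_feasible f) (fun P => fin_min P).

Definition edge_feasible (f : bivariates Om) (rho : messages Om) : Prop :=
  forall i j, (i, j) \in E ->
    forall (xi : Om i) (xj : Om j), rho i j xi + rho j i xj <= f i j xi xj.

Definition node_sum (rho : messages Om) (i : 'I_n) (xi : Om i) : R :=
  \sum_(j in neighbors E i) rho i j xi.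

Definition dual_tree_value (f : bivariates Om) : \bar R :=
  opt_value [set rho | edge_feasible f rho]
    (fun rho => (\sum_(i < n) fin_min (node_sum rho (i:=i)))%E).

Definition dual_lp_value (f : bivariates Om) : \bar R :=
  opt_value
    [set z : ('I_n -> R) * messages Om | edge_feasible f z.2 /\
       forall (i : 'I_n) (xi : Om i), node_sum z.2 xi = z.1 i]
    (fun z => (\sum_(i < n) z.1 i)%:E).

End Problems.

(* Main.v *)
Require Import Defs.
From HB Require Import structures.
From mathcomp Require Import all_boot all_order all_algebra finmap.
From mathcomp Require Import boolp classical_sets reals constructive_ereal ereal.
From mathcomp Require Import ring lra.

Set Implicit Arguments.
Unset Strict Implicit.
Unset Printing Implicit Defensive.

Import Order.TTheory GRing.Theory Num.Theory.

Local Open Scope ring_scope.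

(** The three problems attain exactly the same objective values, so their
suprema agree.

A family of messages satisfying the edge constraints yields the edge functions
[rho i j xi + rho j i xj], whose sum over the edges is
[sum_i node_sum rho (x i)] ([sum_node_sum]).  This is a separable function,
and because the coordinates range independently its minimum is the sum of the
minima of the node sums ([fin_min_sum]).

Conversely, suppose that a separable function [P] is the sum over the edges of
[rho i j (x i) (x j)].  Take the mixed second difference of both sides in the
two coordinates of an edge [(i, j)].  It vanishes on every function which does
not depend on both coordinates, hence on [P], a sum of such functions, and on
the terms of all other edges; it therefore vanishes on [rho i j], which means that [rho i j] is itself
a sum of two univariate functions ([edge_split]).  These are the messages.

Finally, messages can be adjusted without changing the value of the dual tree
relaxation so that all node sums are constant: at each node with a neighbour,
the excess of the node sum over its minimum is subtracted from one message.
Messages only decrease, so the edge constraints persist; at an isolated node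
the node sum is zero already ([flatten_messages]). *)

Lemma opt_value_eq (R : realType) (S T : Type) (A : set S) (B : set T)
    (u : S -> \bar R) (v : T -> \bar R) :
    (forall s, A s -> exists2 t, B t & v t = u s) ->
    (forall t, B t -> exists2 s, A s & u s = v t) ->
  opt_value A u = opt_value B v.
Proof.
move=> AB BA; congr ereal_sup; apply/seteqP; split=> _ [z Hz <-] /=.
  by have [t Bt <-] := AB z Hz; exists t.
by have [s As <-] := BA z Hz; exists s.
Qed.

(** * Minima over finite types *)

Lemma fin_minE (R : realType) (T : finType) (g : T -> R) (x : T) :
  (forall y, g x <= g y) -> fin_min g = (g x)%:E.
Proof.
move=> gx; apply/le_anti/andP; split; first exact: bigmin_le.
apply: le_bigmin => [|y _]; first exact: leey.
by rewrite lee_fin.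
Qed.

Lemma ex_minimizer (R : realType) (T : finType) (g : T -> R) (x0 : T) :
  exists x, forall y, g x <= g y.
Proof.
case: (@arg_minP _ R T x0 xpredT g isT) => x _ Hx.
by exists x => y; exact: Hx.
Qed.

Section Separability.
Variables (R : realType) (n : nat) (Om : 'I_n -> {fset R}).
Implicit Types (x y : config Om) (i j k : 'I_n) (h : config Om -> R).

Lemma fin_min_sum (x0 : config Om) (g : forall i, Om i -> R) :
  fin_min (fun x : config Om => \sum_(i < n) g i (x i)) =
  (\sum_(i < n) fin_min (g i))%E.
Proof.
have mins i : {z : Om i | forall w, g i z <= g i w}.
  by apply: cid; exact: ex_minimizer (x0 i).
pose xm : config Om := [ffun i => sval (mins i)].
have xmP i (z : Om i) : g i (xm i) <= g i z.
  by rewrite ffunE; exact: (svalP (mins i)).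
rewrite (@fin_minE _ _ _ xm) => [|y]; last by apply: ler_sum => i _.
by rewrite -sumEFin; apply: eq_bigr => i _; rewrite (@fin_minE _ _ _ (xm i)).
Qed.

(** * Mixed second differences *)

(** The configuration [x] with its [i]-th coordinate replaced by [a]. *)
Definition update x i (a : Om i) : config Om := [ffun k => dfwith x a k].

Lemma update_in x i (a : Om i) : update x a i = a.
Proof. by rewrite ffunE dfwith_in. Qed.

Lemma update_out x i (a : Om i) k : k != i -> update x a k = x k.
Proof. by move=> ki; rewrite ffunE dfwith_out // eq_sym. Qed.

(** [h] does not depend on the [i]-th coordinate. *)
Definition independent_of i h :=
  forall x y, (forall k, k != i -> x k = y k) -> h x = h y.

(** The mixed second difference of [h] from the base point [x], in the
directions [x i |-> a] and [x j |-> b]. *)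
Definition mixed_diff x i (a : Om i) j (b : Om j) h : R :=
  h (update (update x a) b) - h (update x a) - h (update x b) + h x.

Lemma mixed_diff_sum x i (a : Om i) j (b : Om j) (I : finType) (D : pred I)
    (h : I -> config Om -> R) :
  mixed_diff x a b (fun y => \sum_(k | D k) h k y) =
  \sum_(k | D k) mixed_diff x a b (h k).
Proof. by rewrite /mixed_diff big_split /= !sumrB. Qed.

Lemma mixed_diff_eq0 x i (a : Om i) j (b : Om j) h :
  independent_of i h \/ independent_of j h -> mixed_diff x a b h = 0.
Proof.
rewrite /mixed_diff; case=> hfree.
  rewrite (hfree (update (update x a) b) (update x b)); last first.
    move=> k ki; have [->|kj] := eqVneq k j; first by rewrite !update_in.
    by rewrite !update_out.
  rewrite (hfree (update x a) x); first by ring.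
  by move=> k ki; rewrite update_out.
rewrite (hfree (update (update x a) b) (update x a)); last first.
  by move=> k kj; rewrite update_out.
rewrite (hfree (update x b) x); first by ring.
by move=> k kj; rewrite update_out.
Qed.

Lemma mixed_diff_separable x i (a : Om i) j (b : Om j) (P : config Om -> R) :
  i != j -> separable P -> mixed_diff x a b P = 0.
Proof.
move=> ij [p Pp]; rewrite (funext Pp) mixed_diff_sum big1 // => k _.
apply: mixed_diff_eq0; have [ki|ki] := eqVneq i k.
  by right=> y z yz; rewrite yz // -ki.
by left=> y z yz; rewrite yz // eq_sym.
Qed.

(** * Sums over edges *)

Variable E : {set 'I_n * 'I_n}.
Hypothesis E_lt : forall i j : 'I_n, (i, j) \in E -> (i < j)%N.

Lemma edge_split (P : config Om -> R) (rho : bivariates Om) x i j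
    (a : Om i) (b : Om j) :
    separable P -> (forall y, P y = sum_bivariates E rho y) -> (i, j) \in E ->
  rho i j a b = rho i j a (x j) + (rho i j (x i) b - rho i j (x i) (x j)).
Proof.
move=> sepP PE ijE; have ltij := E_lt ijE.
have ij : i != j by rewrite neq_ltn ltij.
have := mixed_diff_separable x a b ij sepP.
rewrite (funext PE) mixed_diff_sum (bigD1 (i, j)) //= big1 ?addr0 => [|[k l]].
  rewrite /mixed_diff !update_in ?(update_out _ _ ij).
  by rewrite !(update_out _ _ (_ : j != i)) 1?eq_sym // update_in; lra.
rewrite xpair_eqE => /andP[/= klE kl_ij]; have ltkl := E_lt klE.
apply: mixed_diff_eq0.
(* As edges are increasing pairs, an edge other than [(i, j)] misses [i] or
   [j]. *)
have [/andP[ki li]|] := boolP ((k != i) && (l != i)).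
  by left=> y z yz; rewrite !yz.
rewrite negb_and !negbK => kli; right.
suff /andP[kj lj] : (k != j) && (l != j) by move=> y z yz; rewrite !yz.
case/orP: kli => /eqP e; subst.
  by move: kl_ij; rewrite eqxx ij.
by rewrite ij andbT neq_ltn (ltn_trans ltkl).
Qed.

Lemma sum_node_sum (r : messages Om) x :
  \sum_(i < n) node_sum E r (x i) =
  sum_bivariates E (fun i j xi xj => r i j xi + r j i xj) x.
Proof.
rewrite /sum_bivariates big_split /= /node_sum.
transitivity (\sum_i \sum_(j | (i, j) \in E) r i j (x i) +
              \sum_i \sum_(j | (j, i) \in E) r i j (x i)).
  rewrite -big_split /=; apply: eq_bigr => i _.
  rewrite (bigID (fun j => (i, j) \in E)) /=.
  congr (_ + _); apply: eq_bigl => j; rewrite inE.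
    by case: ((i, j) \in E); rewrite ?andbF.
  case ijE: ((i, j) \in E); rewrite ?andbF ?andbT //=.
  by apply/esym/negbTE/negP => /E_lt; rewrite ltnNge ltnW ?E_lt.
congr (_ + _); last rewrite (exchange_big_dep xpredT) //=.
  by rewrite pair_big_dep /=; apply: eq_bigl => -[].
by rewrite pair_big_dep /=; apply: eq_bigl => -[].
Qed.

Lemma fin_min_sum_bivariates (x0 : config Om) (r : messages Om) :
  fin_min (sum_bivariates E (fun i j xi xj => r i j xi + r j i xj)) =
  (\sum_(i < n) fin_min (node_sum E r (i:=i)))%E.
Proof.
rewrite -fin_min_sum //; congr fin_min.
by apply/funext => x; rewrite sum_node_sum.
Qed.

(** * From messages to messages with constant node sums *)

(** Here [m i] is the minimum of the [i]-th node sum of [r]. *)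
Lemma flatten_messages (f : bivariates Om) (r : messages Om)
    (m : 'I_n -> R) :
    edge_feasible E f r ->
    (forall i (z : Om i), m i <= node_sum E r z) ->
    (forall i, exists z : Om i, node_sum E r z = m i) ->
  exists2 s : messages Om, edge_feasible E f s &
    forall i (z : Om i), node_sum E s z = m i.
Proof.
move=> fr mle matt.
pose s : messages Om := fun i j z =>
  if [pick k in neighbors E i] == Some j then r i j z - (node_sum E r z - m i)
  else r i j z.
have sr i j z : s i j z <= r i j z.
  by rewrite /s; case: ifP => // _; rewrite gerBl subr_ge0.
exists s => [i j ijE xi xj|i z].
  exact: le_trans (lerD (sr _ _ _) (sr _ _ _)) (fr _ _ ijE xi xj).
rewrite {1}/node_sum /s; case: pickP => [k kN|noN].
  rewrite (bigD1 k) //= eqxx [node_sum E r z](bigD1 k) //=.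
  rewrite [X in _ + X = _](eq_bigr (fun j => r i j z)) => [|j /andP[_ jk]].
    by ring.
  by rewrite (inj_eq (@Some_inj _)) eq_sym (negbTE jk).
by have [w <-] := matt i; rewrite /node_sum !big_pred0.
Qed.

End Separability.

Theorem mainTheorem7 (R : realType) (n : nat) (Om : 'I_n -> {fset R})
    (Om_neq0 : forall i : 'I_n, Om i != fset0)
    (E : {set 'I_n * 'I_n})
    (E_lt : forall i j : 'I_n, (i, j) \in E -> (i < j)%N)
    (f : bivariates Om)
    (F : config Om -> R)
    (F_sum : forall x : config Om, F x = sum_bivariates E f x) :
  separable_bound_value E f = dual_tree_value E f /\
  dual_tree_value E f = dual_lp_value E f.
Proof.
have pt i : Om i by have /fset0Pn/cid[z zP] := Om_neq0 i; exact: [` zP]%fset.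
pose x0 : config Om := [ffun i => pt i].
split; apply: opt_value_eq => /=.
- move=> P [sepP [rho [rho_f Prho]]].
  (* The two cases are the two univariate functions of [edge_split]: edges being
     increasing pairs, [i < j] when [i] is the first end of the edge. *)
  pose r : messages Om := fun i j z =>
    if (i < j)%N then rho i j z (x0 j)
    else rho j i (x0 j) z - rho j i (x0 j) (x0 i).
  have rE i j xi xj : (i, j) \in E -> r i j xi + r j i xj = rho i j xi xj.
    move=> ijE; have ltij := E_lt _ _ ijE.
    rewrite /r ltij ltnNge (ltnW ltij) /=.
    by rewrite (edge_split E_lt x0 xi xj sepP Prho ijE).
  exists r => [i j ijE xi xj|]; first by rewrite rE // rho_f.
  rewrite -fin_min_sum_bivariates //; congr fin_min; apply/funext => x.
  by rewrite Prho; apply: eq_bigr => -[i j] ijE; rewrite rE.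
- move=> r fr; exists (sum_bivariates E (fun i j xi xj => r i j xi + r j i xj)).
    split; last by exists (fun i j xi xj => r i j xi + r j i xj).
    by exists (node_sum E r) => x; rewrite sum_node_sum.
  exact: fin_min_sum_bivariates.
- move=> r fr.
  have mins i :
      {z : Om i | forall y : Om i, node_sum E r z <= node_sum E r y}.
    by apply: cid; exact: ex_minimizer (pt i).
  pose m i := node_sum E r (sval (mins i)).
  have [||s fs sm] := @flatten_messages _ _ _ E f r m fr.
  + by move=> i z; exact: (svalP (mins i)).
  + by move=> i; exists (sval (mins i)).
  exists (m, s) => //=; rewrite -sumEFin; apply: eq_bigr => i _.
  by rewrite (fin_minE (svalP (mins i))).
- move=> [m s] [/= fs sm]; exists s => //.
  rewrite -sumEFin; apply: eq_bigr => i _.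
  by rewrite (@fin_minE _ _ _ (pt i)) ?sm // => y; rewrite !sm.
Qed.
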